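(* Let $\mathfrak{g}$ be a Lie algebra, $(M,\bullet)$ a $\mathfrak{g}$-module, and $(T,N,S)$ an $\mathcal{ON}$-structure on $M$ over $\mathfrak{g}$. For $k\geq 0$ let $T_k := T\circ S^k = N^k\circ T : M\to\mathfrak{g}$. Then for all $k\geq 0$ the linear map $T_k$ is an $\mathcal{O}$-operator on $M$ over $\mathfrak{g}$. Moreover, for all $k,l\geq 0$, the $\mathcal{O}$-operators $T_k$ and $T_l$ are compatible.
   Context: All vector spaces are over a field of characteristic $0$. An $\mathcal{O}$-operator on a $\mathfrak{g}$-module $(M,\bullet)$ over the Lie algebra $\mathfrak{g}$ is a linear map $T: M\to\mathfrak{g}$ with $[T(m),T(n)] = T(T(m)\bullet n - T(n)\bullet m)$ for all $m,n\in M$. Two $\mathcal{O}$-operators on $M$ over $\mathfrak{g}$ are compatible if their sum is also an $\mathcal{O}$-operator. For any linear map $T:M\to\mathfrak{g}$ put $[m,n]^T := T(m)\bullet n - T(n)\bullet m$. A Nijenhuis operator on $\mathfrak{g}$ is a linear map $N:\mathfrak{g}\to\mathfrak{g}$ with $[Nx,Ny] = N([Nx,y]+[x,Ny]-N[x,y])$ for all $x,y$. A Nijenhuis structure on $M$ over $\mathfrak{g}$ is a pair $(N,S)$ with $N\in\mathrm{End}(\mathfrak{g})$ a Nijenhuis operator and $S\in\mathrm{End}(M)$ satisfying $N(x)\bullet S(m) = S(N(x)\bullet m) + x\bullet S^2(m) - S(x\bullet S(m))$ for all $x\in\mathfrak{g}, m\in M$. An $\mathcal{ON}$-structure on $M$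 over $\mathfrak{g}$ is a triple $(T,N,S)$ where $T$ is an $\mathcal{O}$-operator on $M$ over $\mathfrak{g}$, $(N,S)$ is a Nijenhuis structure on $M$ over $\mathfrak{g}$, $N\circ T = T\circ S$, and $[m,n]^{N\circ T} = [m,n]^T_S$ for all $m,n\in M$, where $[m,n]^T_S := [S(m),n]^T + [m,S(n)]^T - S([m,n]^T)$. *)

(* Defs.v *)
From HB Require Import structures.
From mathcomp Require Import all_boot all_order all_algebra.

Set Implicit Arguments.
Unset Strict Implicit.
Unset Printing Implicit Defensive.

Import GRing.Theory.
Local Open Scope ring_scope.

HB.mixin Record isLieAlgebra (F : fieldType) g of GRing.Lmodule F g := {
  lie_bracket : g -> g -> g;
  lie_bracket_linearl : forall y, linear (fun x => lie_bracket x y);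
  lie_bracket_linearr : forall x, linear (fun y => lie_bracket x y);
  lie_bracket_alt : forall x, lie_bracket x x = 0;
  lie_bracket_jacobi : forall x y z,
    lie_bracket x (lie_bracket y z) + lie_bracket y (lie_bracket z x)
      + lie_bracket z (lie_bracket x y) = 0
}.

#[short(type="lieAlgType")]
HB.structure Definition LieAlgebra (F : fieldType) :=
  {g of GRing.Lmodule F g & isLieAlgebra F g}.

Notation "[| x , y |]" := (lie_bracket x y)
  (at level 0, x, y at level 99, format "[| x ,  y |]") : ring_scope.

HB.mixin Record isLieModule (F : fieldType) (g : lieAlgType F) M
    of GRing.Lmodule F M := {
  lie_act : g -> M -> M;
  lie_act_linearl : forall m, linear (fun x => lie_act x m);
  lie_act_linearr : forall x, linear (fun m => lie_act x m);
  lie_act_bracket : forall x y m,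
    lie_act [| x, y |] m = lie_act x (lie_act y m) - lie_act y (lie_act x m)
}.

#[short(type="lieModType")]
HB.structure Definition LieModule (F : fieldType) (g : lieAlgType F) :=
  {M of GRing.Lmodule F M & isLieModule F g M}.

Notation "x \bullet m" := (lie_act x m)
  (at level 40, left associativity) : ring_scope.

Section IterLinear.
Variables (F : fieldType) (V : lmodType F) (f : {linear V -> V}) (k : nat).

Lemma iter_is_linear : linear (iter k f).
Proof. by move=> a u v; elim: k => //= j ->; rewrite linearP. Qed.

HB.instance Definition _ := GRing.isLinear.Build F V V _ (iter k f) iter_is_linear.

(* The k-th power of f in End(V), as a linear map. *)
Definition lin_pow : {linear V -> V} := iter k f.

End IterLinear.

Section Operators.
Variables (F : fieldType) (g : lieAlgType F) (M : lieModType g).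
Implicit Types (T : {linear M -> g}) (N : {linear g -> g}) (S : {linear M -> M}).

(* [m, n]^T *)
Definition O_bracket T (m n : M) : M := T m \bullet n - T n \bullet m.

(* [m, n]^T_S *)
Definition O_bracket_deformed T S (m n : M) : M :=
  O_bracket T (S m) n + O_bracket T m (S n) - S (O_bracket T m n).

Definition O_operator T : Prop :=
  forall m n : M, [| T m, T n |] = T (T m \bullet n - T n \bullet m).

Definition O_compatible T T' : Prop :=
  [/\ O_operator T, O_operator T' & O_operator (T \+ T')].

Definition Nijenhuis_operator N : Prop :=
  forall x y : g,
    [| N x, N y |] = N ([| N x, y |] + [| x, N y |] - N [| x, y |]).

Definition Nijenhuis_structure N S : Prop :=
  Nijenhuis_operator N /\
  forall (x : g) (m : M),
    N x \bullet S m
      = S (N x \bullet m) + x \bullet S (S m) - S (x \bullet S m).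

Definition ON_structure T N S : Prop :=
  [/\ O_operator T,
      Nijenhuis_structure N S,
      forall m : M, N (T m) = T (S m)
    & forall m n : M, O_bracket (N \o T) m n = O_bracket_deformed T S m n].

Definition ON_iterate T S (k : nat) : {linear M -> g} := T \o lin_pow S k.

End Operators.

(* Main.v *)
Require Import Defs.
From HB Require Import structures.
From mathcomp Require Import all_boot all_order all_algebra.

Set Implicit Arguments.
Unset Strict Implicit.
Unset Printing Implicit Defensive.

Import GRing.Theory.
Local Open Scope ring_scope.

(** Given [N T = T S], the last axiom of an ON-structure says that [S [m, n]^T = Tm.Sn - Tn.Sm].
    Since 2 is invertible, combining this with the compatibility of [(N, S)]
    shows that [S] is a Nijenhuis operator for the bracket [[m, n]^T], so that [(T S, N, S)]
    is again an ON-structure, and hence so is [(T S^k, N, S)] for every [k].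
    An induction on [k] then gives [S^k [m, n]^T = Tm.S^k n - Tn.S^k m], which
    is the polarised O-operator identity between [T] and [T S^k]; applied to
    [T S^l] in place of [T], it yields the compatibility of all pairs. *)

Lemma addrB_swap (V : zmodType) (a b c d : V) :
  a - b + (c - d) = a - d + (c - b).
Proof. by rewrite [c - d]addrC addrACA [- b + c]addrC. Qed.

Section LieBilinear.
Variables (F : fieldType) (g : lieAlgType F) (M : lieModType g).

Lemma lie_bracketDl (x y z : g) : [| x + y, z |] = [| x, z |] + [| y, z |].
Proof. by have := lie_bracket_linearl z 1 x y; rewrite !scale1r. Qed.

Lemma lie_bracketDr (x y z : g) : [| x, y + z |] = [| x, y |] + [| x, z |].
Proof. by have := lie_bracket_linearr x 1 y z; rewrite !scale1r. Qed.

Lemma lie_actDl (x y : g) (m : M) : (x + y) \bullet m = x \bullet m + y \bullet m.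
Proof. by have := lie_act_linearl m 1 x y; rewrite !scale1r. Qed.

End LieBilinear.

Lemma pchar0_opp_eq (F : fieldType) (V : lmodType F) (v : V) :
  [pchar F] =i pred0 -> v = - v -> v = 0.
Proof.
move=> /pcharf0P F0 vN; have : 2%:R *: v = 0.
  by rewrite scaler_nat mulr2n {1}vN addNr.
by move/eqP; rewrite scaler_eq0 F0 => /eqP.
Qed.

Section ONStructures.
Variables (F : fieldType) (g : lieAlgType F) (M : lieModType g).
Implicit Types (T : {linear M -> g}) (N : {linear g -> g}) (S : {linear M -> M}).

Lemma O_operator_add T T' :
  O_operator T -> O_operator T' ->
  (forall m n, [| T m, T' n |] + [| T' m, T n |]
                 = T (O_bracket T' m n) + T' (O_bracket T m n)) ->
  O_operator (T \+ T').
Proof.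
move=> OT OT' TT' m n /=.
have -> : (T m + T' m) \bullet n - (T n + T' n) \bullet m
            = O_bracket T m n + O_bracket T' m n.
  by rewrite !lie_actDl opprD addrACA.
rewrite lie_bracketDl !lie_bracketDr [X in _ + X = _]addrC addrACA TT'.
by rewrite OT OT' !linearD [X in _ = _ + X]addrC [RHS]addrACA.
Qed.

(** Once [N \o T] is rewritten as [T \o S], the terms [T (S m) \bullet n] and [T (S n) \bullet m]
    cancel from the deformation axiom. *)
Lemma ON_bracket T N S : ON_structure T N S ->
  forall m n, S (O_bracket T m n) = T m \bullet S n - T n \bullet S m.
Proof.
move=> [_ _ NT TS] m n; have := TS m n.
rewrite /O_bracket_deformed {1 2 3}/O_bracket /= !NT.
rewrite [X in _ = _ + X - _]addrC addrACA -[X in _ = X -> _]addrA.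
move=> /(canLR (addKr _)); rewrite addNr => /esym/subr0_eq <-.
by rewrite addrC.
Qed.

(** As [O_bracket (T \o S)] is the deformed bracket, this is the vanishing of the Nijenhuis torsion
    of [S]. *)
Lemma ON_torsion T N S (F_char0 : [pchar F] =i pred0) : ON_structure T N S ->
  forall m n, S (O_bracket (T \o S) m n) = O_bracket T (S m) (S n).
Proof.
move=> ON m n; have [_ [_ NS] NT _] := ON.
(* Let A and B be the two sides of the goal. The Nijenhuis structure gives B - A = X - Y,
   [ON_bracket] gives A - B = X - Y, so B - A equals its own opposite. *)
pose X := T m \bullet S (S n) - T n \bullet S (S m).
pose Y := S (T m \bullet S n - T n \bullet S m).
have NS_bracket : O_bracket T (S m) (S n) = S (O_bracket (T \o S) m n) + (X - Y).
  rewrite /O_bracket /= -!NT !NS NT /X /Y !linearB /= !opprD !opprK.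
  by rewrite addrACA [X in X + _]addrACA -!addrA.
have D_bracket : S (O_bracket (T \o S) m n) + Y = O_bracket T (S m) (S n) + X.
  have D1 := ON_bracket ON m (S n); have D2 := ON_bracket ON (S m) n.
  have := congr2 +%R D2 D1; rewrite -linearD => D.
  transitivity (S (O_bracket T (S m) n + O_bracket T m (S n))).
    rewrite -linearD; congr (S _); rewrite /O_bracket /=.
    by rewrite [RHS]addrACA [X in _ = _ + X]addrC -[RHS]addrACA.
  by rewrite D /O_bracket /X addrACA [X in _ + X = _]addrC addrACA.
apply/esym/subr0_eq/pchar0_opp_eq => //.
rewrite {1}NS_bracket addrAC subrr add0r opprB.
by apply/eqP; rewrite subr_eq addrAC eq_sym subr_eq D_bracket addrC.
Qed.

(** The torsion identity serves twice: under [T] it gives the O-operator identity, and it cancels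
    the mixed terms in the deformation axiom. *)
Lemma ON_structure_comp T N S (F_char0 : [pchar F] =i pred0) :
  ON_structure T N S -> ON_structure (T \o S) N S.
Proof.
move=> ON; have tor := ON_torsion F_char0 ON; have [OT NS NT _] := ON.
split=> // [m n|m|m n] /=; first by rewrite OT -/(O_bracket T (S m) (S n)) -tor.
  by rewrite NT.
rewrite /O_bracket_deformed tor /O_bracket /= !NT.
rewrite [X in _ = _ + X - _]addrC addrACA.
by rewrite [X in _ = _ + X - _]addrC addrK.
Qed.

Lemma eq_ON_structure T T' N S :
  T =1 T' -> ON_structure T N S -> ON_structure T' N S.
Proof.
move=> TT' [OT NS NT TS]; split=> // [m n|m|m n].
- by rewrite -!TT' OT.
- by rewrite -!TT' NT.
- have := TS m n; rewrite /O_bracket_deformed /O_bracket /=.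
  by rewrite -!TT'.
Qed.

Lemma ON_structure_iterate T N S (F_char0 : [pchar F] =i pred0) k :
  ON_structure T N S -> ON_structure (ON_iterate T S k) N S.
Proof.
move=> ON; elim: k => [ |k IHk]; first exact: eq_ON_structure ON.
apply: eq_ON_structure (ON_structure_comp F_char0 IHk) => m /=.
by rewrite -iterSr.
Qed.

Lemma ON_bracket_iter T N S (F_char0 : [pchar F] =i pred0) k :
  ON_structure T N S -> forall m n,
  iter k S (O_bracket T m n) = T m \bullet iter k S n - T n \bullet iter k S m.
Proof.
move=> ON m n; elim: k => //= k ->.
(* The sum of [D1] and [D2] is the goal plus [D3], the bracket identity for [T \o S^k]. *)
have D1 := ON_bracket ON m (iter k S n).
have D2 := ON_bracket ON (iter k S m) n.
have D3 := ON_bracket (ON_structure_iterate F_char0 k ON) m n.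
rewrite /O_bracket /= in D1 D2 D3.
have := congr2 +%R D1 D2.
by rewrite -linearD addrB_swap linearD /= D3 [RHS]addrB_swap => /addIr.
Qed.

Lemma ON_iterate_compatible T N S (F_char0 : [pchar F] =i pred0) k :
  ON_structure T N S -> O_operator (T \+ ON_iterate T S k).
Proof.
move=> ON; have [OT _ _ _] := ON.
have [OTk _ _ _] := ON_structure_iterate F_char0 k ON.
apply: O_operator_add => // m n /=.
(* All mixed terms now lie under one [T], where both sides consist of the same four terms. *)
rewrite !OT (ON_bracket_iter F_char0 k ON) -!linearD; congr (T _).
rewrite /O_bracket /=.
by rewrite addrACA [X in _ + X = _]addrC [RHS]addrC addrACA.
Qed.

End ONStructures.

Lemma eq_O_operator (F : fieldType) (g : lieAlgType F) (M : lieModType g)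
    (T T' : {linear M -> g}) : T =1 T' -> O_operator T -> O_operator T'.
Proof. by move=> TT' OT m n; rewrite -!TT' OT. Qed.

Theorem theorem5p12 (F : fieldType) (F_char0 : [pchar F] =i pred0)
    (g : lieAlgType F) (M : lieModType g)
    (T : {linear M -> g}) (N : {linear g -> g}) (S : {linear M -> M})
    (TNS : ON_structure T N S) :
  [/\ forall k : nat, ON_iterate T S k =1 lin_pow N k \o T,
      forall k : nat, O_operator (ON_iterate T S k)
    & forall k l : nat, O_compatible (ON_iterate T S k) (ON_iterate T S l)].
Proof.
have O_iterate k : O_operator (ON_iterate T S k).
  by have [] := ON_structure_iterate F_char0 k TNS.
have O_sum k d : O_operator (ON_iterate T S k \+ ON_iterate T S (d + k)).
  (* The d-th iterate of the ON-structure on [T \o S^k] is [T \o S^(d + k)]. *)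
  apply: eq_O_operator (ON_iterate_compatible F_char0 d
    (ON_structure_iterate F_char0 k TNS)) => m /=.
  by rewrite addnC iterD.
split=> // [k m|k l] /=.
  have [_ _ NT _] := TNS.
  by elim: k => //= k <-; rewrite NT.
(* [O_sum] covers [k <= l]; otherwise the summands are swapped. *)
split=> //; have [lekl|/ltnW lelk] := leqP k l.
  by rewrite -(subnK lekl); apply: O_sum.
rewrite -(subnK lelk); apply: eq_O_operator (O_sum l (k - l)%N) => m /=.
by rewrite addrC.
Qed.
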